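(* Let $a=(a_1,\dots,a_n)$, $b=(b_1,\dots,b_n)$, $c=(c_1,\dots,c_n)\in\mathbb{R}^n$. If $\Lambda(a)+\Lambda(b)\le D(c)$, then $$\left|\sum_{i=1}^{n}a_iA_i\right|^2+\left|\sum_{i=1}^{n}b_iA_i\right|^2\le\sum_{i=1}^{n}c_i|A_i|^2$$ for every $n$-tuple $(A_1,\dots,A_n)$ in $\mathbb{B}(\mathscr{H})$. The statement is also correct if the order is replaced by the reverse: if $\Lambda(a)+\Lambda(b)\ge D(c)$, then $$\left|\sum_{i=1}^{n}a_iA_i\right|^2+\left|\sum_{i=1}^{n}b_iA_i\right|^2\ge\sum_{i=1}^{n}c_i|A_i|^2$$ for every $n$-tuple $(A_1,\dots,A_n)$ in $\mathbb{B}(\mathscr{H})$.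
   Context: $\mathbb{B}(\mathscr{H})$ is the algebra of all bounded linear operators on a complex (separable) Hilbert space $\mathscr{H}$, and $|C|=(C^*C)^{1/2}$ for $C\in\mathbb{B}(\mathscr{H})$. For $x=(x_1,\dots,x_n)\in\mathbb{R}^n$, $\Lambda(x)=(x_ix_j)_{i,j}$ and $D(x)=\mathrm{diag}(x_1,\dots,x_n)$ are $n\times n$ real matrices. The order $\le$ between symmetric matrices or self-adjoint operators is the usual one: $S\le T$ iff $T-S$ is positive semidefinite. *)

(* Defs.v *)
From HB Require Import structures.
From mathcomp Require Import all_boot all_order all_algebra.
From mathcomp Require Import sesquilinear complex.
From mathcomp Require Import boolp classical_sets functions cardinality reals.
From mathcomp Require Import topology normedtype.

Set Implicit Arguments.
Unset Strict Implicit.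
Unset Printing Implicit Defensive.

Import Order.TTheory GRing.Theory Num.Theory.

Local Open Scope ring_scope.
Local Open Scope complex_scope.
Local Open Scope classical_set_scope.

(* The inner product is linear in its first argument and conjugate-linear in
   the second; the norm of the complete space H is the one it induces. *)
HB.mixin Record CompleteNormedModule_isHilbert (R : realType) H
    of CompleteNormedModule R[i] H := {
  inner : {dot H for (@Num.conj R[i])} ;
  sqr_norm_inner : forall x : H, `|x| ^+ 2 = inner x x
}.

#[short(type="hilbertType")]
HB.structure Definition Hilbert (R : realType) :=
  {H of CompleteNormedModule_isHilbert R H & CompleteNormedModule R[i] H}.

Arguments inner {R s}.

Definition separable_space (T : topologicalType) : Prop :=
  exists2 S : set T, countable S & dense S.

Definition bounded_linear (R : realType) (H : hilbertType R) : {pred H -> H} :=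
  fun f => `[< linear f /\
    exists M : R, forall x : H, `|f x| <= M%:C * `|x| >].

Section BoundedLinear.
Variables (R : realType) (H : hilbertType R).

Lemma bounded_linear_submod_closed : submod_closed (@bounded_linear R H).
Proof.
split.
- apply/asboolP; split; first by move=> a x y; rewrite scaler0 addr0.
  by exists 0 => x; rewrite normr0 mul0r.
- move=> a f g /asboolP[lf [M Mf]] /asboolP[lg [N Ng]]; apply/asboolP; split.
    move=> k x y; rewrite !fctE lf lg !scalerDr !scalerA (mulrC a k).
    by rewrite addrACA.
  have [r ar] : exists r : R, `|a| = r%:C.
    by exists (complex.Re `|a|); rewrite RRe_real ?normr_real.
  exists (r * M + N) => x; rewrite !fctE (le_trans (ler_normD _ _))//.
  rewrite rmorphD rmorphM/= mulrDl lerD// normrZ -ar -mulrA.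
  by rewrite ler_wpM2l.
Qed.

HB.instance Definition _ :=
  GRing.isSubmodClosed.Build R[i] (H -> H) (@bounded_linear R H)
    (GRing.submod_closed_semi bounded_linear_submod_closed).

Lemma bounded_linear_id : (id : H -> H) \in @bounded_linear R H.
Proof. by apply/asboolP; split=> //; exists 1 => x; rewrite mul1r. Qed.

Lemma bounded_linear_comp (f g : H -> H) : f \in @bounded_linear R H ->
  g \in @bounded_linear R H -> f \o g \in @bounded_linear R H.
Proof.
move=> /asboolP[lf [M Mf]] /asboolP[lg [N Ng]]; apply/asboolP; split.
  by move=> k x y /=; rewrite lg lf.
exists (`|M| * N) => x /=; rewrite (le_trans (Mf _))// rmorphM/= -mulrA.
rewrite (le_trans (ler_wpM2r _ (_ : M%:C <= `|M|%:C)))// ?lecR ?ler_norm//.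
by rewrite ler_wpM2l// lecR.
Qed.

End BoundedLinear.

Record bounded_operator (R : realType) (H : hilbertType R) := BoundedOperator {
  bop_fun :> H -> H;
  bop_funP : bop_fun \in @bounded_linear R H
}.

Notation "''B' ( H )" := (bounded_operator H) (at level 8, format "''B' ( H )")
  : type_scope.

HB.instance Definition _ (R : realType) (H : hilbertType R) :=
  [isSub for @bop_fun R H].
HB.instance Definition _ (R : realType) (H : hilbertType R) :=
  [Choice of 'B(H) by <:].
HB.instance Definition _ (R : realType) (H : hilbertType R) :=
  [SubChoice_isSubLmodule of 'B(H) by <:].

Section BoundedOperatorRing.
Variables (R : realType) (H : hilbertType R).
Implicit Types S T U : 'B(H).

Definition bop_id : 'B(H) := BoundedOperator (bounded_linear_id H).
Definition bop_comp S T : 'B(H) :=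
  BoundedOperator (bounded_linear_comp (bop_funP S) (bop_funP T)).

Lemma bop_compA : associative bop_comp.
Proof. by move=> S T U; apply/val_inj. Qed.
Lemma bop_comp1l : left_id bop_id bop_comp.
Proof. by move=> S; apply/val_inj. Qed.
Lemma bop_comp1r : right_id bop_id bop_comp.
Proof. by move=> S; apply/val_inj. Qed.
Lemma bop_compDl : left_distributive bop_comp +%R.
Proof. by move=> S T U; apply/val_inj. Qed.
Lemma bop_compDr : right_distributive bop_comp +%R.
Proof.
move=> S T U; apply/val_inj/funext => x /=.
have /asboolP[lS _] := bop_funP S.
by have := lS 1 (T x) (U x); rewrite !scale1r.
Qed.

HB.instance Definition _ := GRing.Zmodule_isPzRing.Build 'B(H)
  bop_compA bop_comp1l bop_comp1r bop_compDl bop_compDr.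

End BoundedOperatorRing.

Section OperatorOrder.
Variables (R : realType) (H : hilbertType R).
Implicit Types S T C : 'B(H).

(* In R[i], 0 <= z means that z is real and nonnegative; over the complex
   scalars this makes a positive operator self-adjoint. *)
Definition positive_op T : Prop := forall x : H, 0 <= inner (T x) x.

Definition op_le S T : Prop := positive_op (T - S).

(* [xget] selects the unique operator with the stated property: it exists for
   every T for [adjoint] (Riesz), and for every positive T for [sqrt_op]; 0 is
   only a default value. *)
Definition adjoint T : 'B(H) :=
  xget 0 [set S : 'B(H) | forall x y : H, inner (T x) y = inner x (S y)].

Definition sqrt_op T : 'B(H) :=
  xget 0 [set S : 'B(H) | positive_op S /\ S ^+ 2 = T].

Definition abs_op C : 'B(H) := sqrt_op (adjoint C * C).

End OperatorOrder.

Section RealMatrices.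
Variables (R : realType) (n : nat).

Definition psdmx (M : 'M[R]_n) : Prop :=
  M^T = M /\ forall v : 'rV[R]_n, 0 <= (v *m M *m v^T) 0 0.

Definition mx_le (M N : 'M[R]_n) : Prop := psdmx (N - M).

Definition Lambda (x : 'rV[R]_n) : 'M[R]_n := \matrix_(i, j) (x 0 i * x 0 j).

End RealMatrices.

(* Main.v *)
Require Import Defs.
From HB Require Import structures.
From mathcomp Require Import all_boot all_order all_algebra.
From mathcomp Require Import ring lra.
From mathcomp Require Import sesquilinear complex spectral.
From mathcomp Require Import boolp classical_sets functions cardinality reals.
From mathcomp Require Import topology normedtype.

Set Implicit Arguments.
Unset Strict Implicit.
Unset Printing Implicit Defensive.

Import Order.TTheory GRing.Theory Num.Theory.

Local Open Scope ring_scope.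
Local Open Scope complex_scope.

(** For a fixed vector [x], put [y i = A i x]. Since [|C|^2 = C^* C], the
    quadratic form of [|C|^2] at [x] is [inner (C x) (C x)]; so the difference
    of the two sides of either inequality, taken at [x], is the sum over [i, j]
    of [M i j * inner (y i) (y j)], where [M] is the difference of the two real
    matrices that the hypothesis declares positive semidefinite. Such a sum is
    nonnegative: a positive semidefinite [M] is a nonnegative combination of
    rank one matrices [conj (p i) * p j] (spectral theorem), and each of these
    contributes the squared norm of a combination of the [y i]
    ([psdmx_gram_ge0]). The two inequalities are the cases [M = D - L] and
    [M = L - D] of this fact, with [L] the sum of the two Lambda matrices and
    [D] the diagonal one.

    The identity [|C|^2 = C^* C] ([sqr_abs_op]) requires that adjoints and
    square roots exist.

    - Adjoints come from the Riesz representation theorem ([riesz]): a bounded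
      functional [f] is represented by a minimiser of [|z|^2 - 2 f z], and the
      parallelogram identity makes any minimising sequence Cauchy.

    - For the square root, rescale [C^* C] to an operator [P] with
      [|x - P x| <= |x|] and set [Q = 1 - P]. If [Y = (Q + Y^2) / 2], then
      [(1 - Y)^2 = P]. The iterates [Y_(n+1) = (Q + Y_n^2) / 2] from [Y_0 = 0]
      have increments bounded in norm by those of the scalar recurrence
      [t_(n+1) = (1 + t_n^2) / 2], which increases to [1]; hence they converge
      ([sqrt_contraction]).

    Both limits are taken with the explicit rate [K / (n + 1)], which leaves a
    single use of completeness ([complete_rate]). The estimates are real, so
    they are made with the real parts of the norm and of the inner product. *)

(** * The underlying real inner product space *)

Section RealStructure.
Context {R : realType} {H : hilbertType R}.
Implicit Types (x y z : H) (r : R).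

Definition rnorm x : R := complex.Re `|x|.

Definition rinner x y : R := complex.Re (inner x y).

Lemma rnormE x : `|x| = (rnorm x)%:C.
Proof. by rewrite /rnorm RRe_real ?normr_real. Qed.

Lemma rnorm_ge0 x : 0 <= rnorm x.
Proof. by rewrite -lecR -rnormE normr_ge0. Qed.

Lemma rnormD x y : rnorm (x + y) <= rnorm x + rnorm y.
Proof. by rewrite -lecR rmorphD /= -!rnormE; exact: ler_normD. Qed.

Lemma rnormN x : rnorm (- x) = rnorm x.
Proof. by rewrite /rnorm normrN. Qed.

Lemma rnormZ (a : R[i]) x : rnorm (a *: x) = complex.Re `|a| * rnorm x.
Proof.
by apply: complexI; rewrite -rnormE normrZ rmorphM /= -rnormE.
Qed.

Lemma rnormZr r x : rnorm (r%:C *: x) = `|r| * rnorm x.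
Proof. by rewrite rnormZ normc_def /= expr0n addr0 sqrtr_sqr. Qed.

Lemma rnorm0 : rnorm 0 = 0.
Proof. by rewrite /rnorm normr0. Qed.

Lemma rnorm_eq0 x : rnorm x = 0 -> x = 0.
Proof. by move=> x0; apply/eqP; rewrite -normr_eq0 rnormE x0. Qed.

Lemma rinnerC x y : rinner x y = rinner y x.
Proof. by rewrite /rinner hermC expr0 mul1r /=; case: (inner y x). Qed.

Lemma rinnerDl x y z : rinner (x + y) z = rinner x z + rinner y z.
Proof. by rewrite /rinner linearDl; exact: raddfD. Qed.

Lemma rinnerZl r x y : rinner (r%:C *: x) y = r * rinner x y.
Proof.
rewrite /rinner linearZl_LR /=; case: (inner x y) => p q.
by rewrite /= mul0r subr0.
Qed.

Lemma rinnerNl x y : rinner (- x) y = - rinner x y.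
Proof. by rewrite /rinner linearNl; exact: raddfN. Qed.

Lemma rinnerDr x y z : rinner z (x + y) = rinner z x + rinner z y.
Proof. by rewrite ![rinner z _]rinnerC rinnerDl. Qed.

Lemma rinnerZr r x y : rinner y (r%:C *: x) = r * rinner y x.
Proof. by rewrite ![rinner y _]rinnerC rinnerZl. Qed.

Lemma rinnerNr x y : rinner y (- x) = - rinner y x.
Proof. by rewrite ![rinner y _]rinnerC rinnerNl. Qed.

Lemma innerxx x : inner x x = (rnorm x ^+ 2)%:C.
Proof. by rewrite -sqr_norm_inner rnormE -rmorphXn. Qed.

Lemma rinnerxx x : rinner x x = rnorm x ^+ 2.
Proof. by rewrite /rinner innerxx. Qed.

Lemma rnormD_sqr x y :
  rnorm (x + y) ^+ 2 = rnorm x ^+ 2 + 2 * rinner x y + rnorm y ^+ 2.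
Proof. rewrite -!rinnerxx rinnerDl !rinnerDr (rinnerC y x); ring. Qed.

(** Cauchy-Schwarz, by polarization: expand both sides of the squared triangle
    inequality, which the norm satisfies by assumption. *)
Lemma rinner_le x y : rinner x y <= rnorm x * rnorm y.
Proof.
have := rnormD_sqr x y; have := rnormD x y.
have := rnorm_ge0 x; have := rnorm_ge0 y; have := rnorm_ge0 (x + y).
set a := rnorm x; set b := rnorm y; set c := rnorm (x + y) => c0 b0 a0 cab e.
have : c ^+ 2 <= (a + b) ^+ 2 by rewrite lerXn2r ?nnegrE ?addr_ge0.
by rewrite e sqrrD; lra.
Qed.

Lemma norm_rinner_le x y : `|rinner x y| <= rnorm x * rnorm y.
Proof.
rewrite ler_norml rinner_le andbT lerNl -rinnerNl.
by rewrite (le_trans (rinner_le _ _))// rnormN.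
Qed.

Lemma parallelogram x y :
  rnorm (x - y) ^+ 2 + rnorm (x + y) ^+ 2
    = 2 * rnorm x ^+ 2 + 2 * rnorm y ^+ 2.
Proof. rewrite !rnormD_sqr rnormN rinnerNr; ring. Qed.

(** The inner product is linear in its first argument, so its imaginary part
    is the real part obtained after multiplying that argument by [-'i]. *)
Lemma inner_rinner x y : inner x y = (rinner x y) +i* (rinner (- 'i%C *: x) y).
Proof.
rewrite /rinner linearZl_LR /= mulNr raddfN /= mulrC ReiNIm opprK.
by case: (inner x y).
Qed.

End RealStructure.

(** * Limits with an explicit rate *)

Section Rate.
Context {R : realType}.

Lemma rate_gt0 (n : nat) : 0 < n.+1%:R^-1 :> R.
Proof. by rewrite invr_gt0 ltr0n. Qed.

Lemma rate_anti (n m : nat) : (n <= m)%N -> m.+1%:R^-1 <= n.+1%:R^-1 :> R.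
Proof. by move=> nm; rewrite lef_pV2 ?posrE ?ltr0n// ler_nat. Qed.

Lemma rate_lt (e : R) : 0 < e -> exists n : nat, n.+1%:R^-1 < e.
Proof.
move=> e0; exists (Num.bound e^-1).
rewrite invf_plt ?posrE ?ltr0n//.
apply: lt_le_trans (archi_boundP _) _; first by rewrite invr_ge0 ltW.
by rewrite ler_nat.
Qed.

(** Passage to the limit in an inequality, in the only form used below. *)
Lemma le0_rate (e K : R) : (forall n : nat, e <= K * n.+1%:R^-1) -> e <= 0.
Proof.
move=> eK; rewrite leNgt; apply/negP => e0.
have K1 : 0 < `|K| + 1 by rewrite ltr_wpDl.
have [n ne] := @rate_lt (e / (`|K| + 1)) (divr_gt0 e0 K1).
have := eK n; apply/negP; rewrite -ltNge.
rewrite ltr_pdivlMr// in ne; apply: le_lt_trans ne.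
rewrite mulrC ler_pM2l ?rate_gt0//.
by rewrite (le_trans (ler_norm K))// lerDl.
Qed.

End Rate.

Section Completeness.
Context {R : realType} {H : hilbertType R}.
Implicit Types (x y z : H).

Lemma rnorm_rate0 z (K : R) :
  (forall n : nat, rnorm z <= K * n.+1%:R^-1) -> z = 0.
Proof.
by move=> /le0_rate z0; apply/rnorm_eq0/le_anti; rewrite z0 rnorm_ge0.
Qed.

(** The bound survives in the limit, so that estimates on the limit follow from
    those on the sequence. *)
Lemma complete_rate (u : nat -> H) (K : R) :
  (forall n m : nat, (n <= m)%N -> rnorm (u m - u n) <= K * n.+1%:R^-1) ->
  exists l, forall n : nat, rnorm (l - u n) <= K * n.+1%:R^-1.
Proof.
move=> uK.
have K0 : 0 <= K.
  by have := uK 0%N 0%N isT; rewrite invr1 mulr1; apply/le_trans/rnorm_ge0.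
have cu : cvg (u @ \oo)%classic.
  apply: cauchy_cvg; apply: cauchy_exP => e e0.
  have er : e = (complex.Re e)%:C by rewrite RRe_real ?ger0_real// ltW.
  have r0 : 0 < complex.Re e by rewrite -ltcR -er.
  have [n nK] : exists n : nat, K * n.+1%:R^-1 < complex.Re e.
    have [n ne] := @rate_lt R (complex.Re e / (K + 1))
      (divr_gt0 r0 (ltr_wpDl K0 ltr01)).
    exists n; rewrite ltr_pdivlMr ?ltr_wpDl// mulrDr mulr1 mulrC in ne.
    by apply: le_lt_trans ne; rewrite lerDl ltW ?rate_gt0.
  exists (u n); exists n => // m /= nm.
  by rewrite -ball_normE /= distrC rnormE er ltcR (le_lt_trans (uK _ _ nm)).
exists (lim (u @ \oo)%classic) => n.
apply/ler_addgt0Pr => e e0.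
have /cvgrPdist_lt /(_ e%:C) := cu.
rewrite ltcR => /(_ e0) [N _ /(_ (maxn N n))/=].
rewrite leq_maxl => /(_ isT); rewrite rnormE ltcR => lu.
rewrite -(subrK (u (maxn N n)) (lim _)) -addrA.
apply: le_trans (rnormD _ _) _; rewrite [leRHS]addrC.
apply: lerD; first exact: ltW.
by apply: uK; exact: leq_maxr.
Qed.

End Completeness.

(** * Riesz representation and adjoints *)

Section Riesz.
Context {R : realType} {H : hilbertType R}.
Implicit Types (x y z : H).

(** If [m] is the infimum of [J z = |z|^2 - 2 f z], the parallelogram identity
    gives [|x - y|^2 <= 2 (J x - m) + 2 (J y - m)], because the midpoint of [x]
    and [y] has [J >= m]. So points with [J z < m + 1 / (n + 1)^2] converge,
    and stationarity of [J] at the limit is the representation of [f]. *)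
Lemma riesz (f : H -> R) (M : R) :
  (forall r x y, f (r%:C *: x + y) = r * f x + f y) ->
  (forall x, f x <= M * rnorm x) ->
  exists z, forall x, f x = rinner x z.
Proof.
move=> flin fM.
pose J z := rnorm z ^+ 2 - 2 * f z.
have fZD r z h : f (z + r%:C *: h) = f z + r * f h.
  by rewrite addrC flin addrC.
pose V := [set J z | z in [set: H]]%classic.
have J0 : has_inf V.
  split; first by exists (J 0); exists 0.
  exists (- M ^+ 2) => _ [z _ <-]; rewrite /J.
  have := fM z; have := sqr_ge0 (rnorm z - M); nra.
have Jge z : inf V <= J z by apply: ge_inf; [case: J0 | exists z].
have /choice[u uJ] (n : nat) : exists z, J z < inf V + n.+1%:R^-1 ^+ 2.
  have [_ [z _ <-] ?] := inf_adherent (exprn_gt0 2 (rate_gt0 n)) J0.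
  by exists z.
have fmid x y : f ((2^-1)%:C *: (x + y)) = (f x + f y) / 2.
  have f0 : f 0 = 0.
    by have := flin 1 0 0; rewrite scaler0 addr0 mul1r; lra.
  have fD : f (x + y) = f x + f y by have := flin 1 x y; rewrite scale1r mul1r.
  by have := flin 2^-1 (x + y) 0; rewrite addr0 f0 fD; lra.
have Jclose x y (e : R) : J x < inf V + e -> J y < inf V + e ->
    rnorm (x - y) ^+ 2 <= 4 * e.
  have := Jge ((2^-1)%:C *: (x + y)); rewrite /J fmid rnormZr.
  rewrite ger0_norm ?invr_ge0// exprMn => Jm Jx Jy.
  have := parallelogram x y; nra.
have uC (n m : nat) : (n <= m)%N -> rnorm (u m - u n) <= 2 * n.+1%:R^-1.
  move=> nm.
  have um : J (u m) < inf V + n.+1%:R^-1 ^+ 2.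
    apply: lt_le_trans (uJ m) _; rewrite lerD2l.
    by rewrite ler_pXn2r ?rate_anti// nnegrE ltW ?rate_gt0.
  have := Jclose _ _ _ um (uJ n).
  have -> : 4 * n.+1%:R^-1 ^+ 2 = (2 * n.+1%:R^-1) ^+ 2 :> R by ring.
  by rewrite ler_pXn2r// nnegrE ?rnorm_ge0// mulr_ge0// ltW ?rate_gt0.
have [z zu] := complete_rate uC.
exists z => h.
(* Stationarity up to an error: [u n] minimises [J] up to [1 / (n + 1)^2], so
   [J (u n + r h)] cannot be smaller than [J (u n)] by more than that. *)
have step (n : nat) (r : R) : 0 <= r ^+ 2 * rnorm h ^+ 2
    + 2 * r * (rinner h (u n) - f h) + n.+1%:R^-1 ^+ 2.
  have := Jge (u n + r%:C *: h); have := uJ n.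
  rewrite /J rnormD_sqr rnormZr exprMn real_normK ?num_real// fZD rinnerZr.
  rewrite (rinnerC h).
  move: (inf V) (n.+1%:R^-1) (rinner _ _) (rnorm _) (f _) (rnorm h).
  move=> i e g a b c; lra.
have near n : `|rinner h (u n) - f h| <= (rnorm h ^+ 2 + 1) / 2 * n.+1%:R^-1.
  (* With [r = e] or [- e], the outer terms of [step] have order [e^2], which
     forces the bracket in the middle one to have order [e]. *)
  have e0 := @rate_gt0 R n; set e := n.+1%:R^-1 in e0 *.
  have := step n e; have := step n (- e); rewrite -/e !sqrrN => s1 s2.
  by rewrite ler_norml; apply/andP; split; rewrite -(ler_pM2l e0); nra.
apply/eqP; rewrite -subr_eq0 -normr_le0.
apply: (@le0_rate _ _ (2 * rnorm h + (rnorm h ^+ 2 + 1) / 2)) => n.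
have -> : f h - rinner h z = - (rinner h (u n) - f h) - rinner h (z - u n).
  by rewrite rinnerDr rinnerNr; ring.
rewrite (le_trans (ler_normB _ _))// normrN mulrDl addrC lerD// -mulrA mulrCA.
by rewrite (le_trans (norm_rinner_le _ _))// ler_wpM2l ?rnorm_ge0.
Qed.

End Riesz.

Section Adjoint.
Context {R : realType} {H : hilbertType R}.
Implicit Types (x y z : H) (S T C : 'B(H)).

Lemma bopP T a x y : T (a *: x + y) = a *: T x + T y.
Proof. by have /asboolP[lT _] := bop_funP T; exact: lT. Qed.

Lemma bopZ T a x : T (a *: x) = a *: T x.
Proof.
have T0 : T 0 = 0.
  by have := bopP T (-1) 0 0; rewrite scaleN1r addNr scaleN1r addNr.
by rewrite -[a *: x]addr0 bopP T0 addr0.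
Qed.

Lemma bopD T x y : T (x + y) = T x + T y.
Proof. by have := bopP T 1 x y; rewrite !scale1r. Qed.

Lemma bopN T x : T (- x) = - T x.
Proof. by rewrite -scaleN1r bopZ scaleN1r. Qed.

Lemma bop_bound T : exists2 M : R, 0 < M & forall x, rnorm (T x) <= M * rnorm x.
Proof.
have /asboolP[_ [M TM]] := bop_funP T.
exists (`|M| + 1) => [|x]; first by rewrite ltr_wpDl.
have := TM x; rewrite !rnormE -rmorphM lecR => /le_trans; apply.
rewrite ler_wpM2r ?rnorm_ge0// (le_trans (ler_norm M))// lerDl//.
Qed.

Lemma bop_ofP (f : H -> H) (M : R) :
  (forall a x y, f (a *: x + y) = a *: f x + f y) ->
  (forall x, rnorm (f x) <= M * rnorm x) ->
  exists T : 'B(H), forall x, T x = f x.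
Proof.
move=> flin fM; have fB : f \in @bounded_linear R H.
  apply/asboolP; split; first exact: flin.
  by exists M => x; rewrite !rnormE -rmorphM lecR.
by exists (BoundedOperator fB).
Qed.

(** By complex linearity, a real adjunction is a complex one. *)
Lemma inner_rinner_eq S T : (forall x y, rinner (S x) y = rinner x (T y)) ->
  forall x y, inner (S x) y = inner x (T y).
Proof. by move=> ST x y; rewrite !inner_rinner -bopZ !ST. Qed.

Lemma innerPr a x y z : inner z (a *: x + y) = a^* * inner z x + inner z y.
Proof. by rewrite linearPr. Qed.

Lemma inner_inj y z : (forall x, inner x y = inner x z) -> y = z.
Proof.
move=> yz; apply/eqP; rewrite -subr_eq0; apply/eqP/rnorm_eq0/eqP.
by rewrite -sqrf_eq0 -rinnerxx rinnerDr rinnerNr {1}/rinner yz subrr.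
Qed.

Lemma rnorm_le_sqr y (c : R) : 0 <= c -> rnorm y ^+ 2 <= c * rnorm y ->
  rnorm y <= c.
Proof.
move=> c0; have := rnorm_ge0 y; rewrite le_eqVlt => /predU1P[<-//|y0].
by rewrite expr2 ler_pM2r.
Qed.

Lemma adjoint_exists T :
  exists S : 'B(H), forall x y, inner (T x) y = inner x (S y).
Proof.
have [M M0 TM] := bop_bound T.
have /choice[s sP] y : exists z, forall x, inner (T x) y = inner x z.
  have [|x|z zP] := @riesz R H (fun x => rinner (T x) y) (M * rnorm y).
  - by move=> r x z; rewrite bopP rinnerDl rinnerZl.
  - by rewrite (le_trans (rinner_le _ _))// mulrAC ler_wpM2r ?rnorm_ge0.
  - by exists z => x; rewrite !inner_rinner -bopZ !zP.
have [|y|S SE] := @bop_ofP s M.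
- move=> a x y; apply: inner_inj => z.
  by rewrite -sP !innerPr !sP.
- apply: rnorm_le_sqr; first by rewrite mulr_ge0 ?rnorm_ge0 ?ltW.
  rewrite -rinnerxx /rinner -sP -/(rinner _ _) (le_trans (rinner_le _ _))//.
  by rewrite mulrAC ler_wpM2r ?rnorm_ge0.
- by exists S => x y; rewrite SE.
Qed.

Lemma adjointP T x y : inner (T x) y = inner x (adjoint T y).
Proof.
have [S SP] := adjoint_exists T; rewrite /adjoint.
by case: xgetP => [_ _ -> //|/(_ S)].
Qed.

Lemma rinner_adjoint T x y : rinner (T x) y = rinner x (adjoint T y).
Proof. by rewrite /rinner adjointP. Qed.

(** From [|C^* y|^2 = <C C^* y, y> <= M |C^* y| |y|]. *)
Lemma rnorm_adjoint T (M : R) :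
  0 <= M -> (forall x, rnorm (T x) <= M * rnorm x) ->
  forall y, rnorm (adjoint T y) <= M * rnorm y.
Proof.
move=> M0 TM y; apply: rnorm_le_sqr; first by rewrite mulr_ge0 ?rnorm_ge0.
rewrite -rinnerxx -rinner_adjoint (le_trans (rinner_le _ _))//.
by rewrite mulrAC ler_wpM2r ?rnorm_ge0.
Qed.

End Adjoint.

(** * Operator limits *)

Section OperatorLimit.
Context {R : realType} {H : hilbertType R}.
Implicit Types (x y z : H).

(** The pointwise limit is linear because the defect of linearity of the limit
    is the limit of that of the [T n], which is zero. *)
Lemma bop_complete (T : nat -> 'B(H)) (K : R) :
  (forall n m : nat, (n <= m)%N ->
    forall x, rnorm (T m x - T n x) <= K * rnorm x * n.+1%:R^-1) ->
  exists T' : 'B(H), forall (n : nat) x,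
    rnorm (T' x - T n x) <= K * rnorm x * n.+1%:R^-1.
Proof.
move=> TK.
have /choice[f fT] x : exists l, forall n : nat,
    rnorm (l - T n x) <= K * rnorm x * n.+1%:R^-1.
  by apply: complete_rate => n m nm; exact: TK.
have [M _ TM] := bop_bound (T 0%N).
have [|x|T' T'E] := @bop_ofP R H f (K + M).
- move=> a x y; apply/eqP; rewrite -subr_eq0; apply/eqP.
  apply: (@rnorm_rate0 _ _ _ (K * rnorm (a *: x + y)
    + complex.Re `|a| * (K * rnorm x) + K * rnorm y)) => n.
  have -> : f (a *: x + y) - (a *: f x + f y) =
      (f (a *: x + y) - T n (a *: x + y)) - a *: (f x - T n x)
      - (f y - T n y).
    rewrite bopP scalerBr !opprB -[in RHS]addrA (addrACA (a *: T n x)).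
    by rewrite [RHS]addrA subrK opprD.
  rewrite !mulrDl (le_trans (rnormD _ _))// lerD//; last by rewrite rnormN.
  rewrite (le_trans (rnormD _ _))// lerD// rnormN rnormZ -mulrA.
  by rewrite ler_wpM2l// -ler0c RRe_real ?normr_real ?normr_ge0.
- rewrite -(subrK (T 0%N x) (f x)) mulrDl (le_trans (rnormD _ _))// lerD//.
  by have := fT x 0%N; rewrite invr1 mulr1.
- by exists T' => n x; rewrite T'E.
Qed.

End OperatorLimit.

(** * Square roots of positive operators *)

Section SquareRoot.
Context {R : realType} {H : hilbertType R}.
Implicit Types (x y z : H) (C P Q : 'B(H)).

Definition symmetric_op P := forall x y, rinner (P x) y = rinner x (P y).

(** Positivity includes that the complex number [inner (P x) x] is real, which
    symmetry provides. *)
Lemma symmetric_positive P : symmetric_op P ->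
  (forall x, 0 <= rinner (P x) x) -> positive_op P.
Proof.
move=> Psym P0 x; rewrite lecE /= P0 andbT.
have := inner_rinner_eq Psym x x; rewrite [inner x (P x)]hermC expr0 mul1r /=.
by case: (inner (P x) x) => p q [] /eqP; rewrite -addr_eq0 -mulr2n mulrn_eq0.
Qed.

(** Iteration towards the solution [Y] of [Y = (Q + Y^2) / 2], that is, of
    [(1 - Y)^2 = 1 - Q]. *)
Definition sqrt_iter Q (n : nat) : 'B(H) :=
  iter n (fun Y : 'B(H) => (2^-1)%:C *: (Q + Y * Y)) 0.

(** The same iteration for the scalar [1], the bound on the norm of [Q]. *)
Definition majorant (n : nat) : R := iter n (fun t => (1 + t ^+ 2) / 2) 0.

Lemma majorantS n : majorant n.+1 = (1 + majorant n ^+ 2) / 2.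
Proof. by []. Qed.

Lemma majorant_itv n : 0 <= majorant n /\ majorant n <= 1.
Proof. by elim: n => [//|n]; rewrite majorantS => -[m0 m1]; split; nra. Qed.

(** The gap [d_n = 1 - t_n] satisfies [d_(n+1) = d_n (1 - d_n / 2)], hence
    [1 / d_(n+1) >= 1 / d_n + 1 / 2] and [d_n <= 2 / (n + 2)]. *)
Lemma majorant_rate n : 1 - majorant n <= 2 * n.+1%:R^-1.
Proof.
(* The induction needs the sharper [n + 2]. *)
suff mN : (1 - majorant n) * n.+2%:R <= 2.
  rewrite ler_pdivlMr ?ltr0n//; apply: le_trans mN.
  have [_ m1] := majorant_itv n.
  by rewrite ler_wpM2l ?subr_ge0// ler_nat.
elim: n => [|n IH]; first by rewrite subr0 mul1r.
have [m0 m1] := majorant_itv n; have [_] := majorant_itv n.+1.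
rewrite majorantS; set t := majorant n in IH m0 m1 * => m1'.
(* Multiplying by [d = 1 - t] replaces the division in [1 / d]. *)
have [t1|t1] := eqVneq t 1; first by rewrite t1; lra.
have d0 : 0 < 1 - t by rewrite subr_gt0 lt_neqAle t1.
rewrite -(ler_pM2l d0) -[n.+3%:R]natr1.
move: n.+2%:R IH => N.
have {m1'} : 0 <= 1 - (1 + t ^+ 2) / 2 by rewrite subr_ge0.
have -> : 1 - (1 + t ^+ 2) / 2 = (1 - t) - (1 - t) ^+ 2 / 2 by lra.
move: (1 - t) d0 => d d0 d'0 /(ler_wpM2l d'0) dN.
have d2 : 0 <= d ^+ 3 by rewrite exprn_ge0// ltW.
by lra.
Qed.

Lemma sqrt_iterS Q n x :
  sqrt_iter Q n.+1 x = (2^-1)%:C *: (Q x + sqrt_iter Q n (sqrt_iter Q n x)).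
Proof. by []. Qed.

Lemma rnorm_half x : rnorm ((2^-1)%:C *: x) = rnorm x / 2.
Proof. by rewrite rnormZr ger0_norm ?invr_ge0// mulrC. Qed.

Section Contraction.
Variable Q : 'B(H).
Hypothesis Q1 : forall x, rnorm (Q x) <= rnorm x.
Hypothesis Qsym : symmetric_op Q.

Lemma rnorm_sqrt_iter n x : rnorm (sqrt_iter Q n x) <= majorant n * rnorm x.
Proof.
elim: n x => [|n IH] x; first by rewrite rnorm0 mul0r.
rewrite sqrt_iterS majorantS rnorm_half.
have := rnormD (Q x) (sqrt_iter Q n (sqrt_iter Q n x)).
have := Q1 x; have := IH (sqrt_iter Q n x); have := IH x.
have [m0 _] := majorant_itv n; move: (majorant n) m0 => t t0.
move: (rnorm (sqrt_iter Q n x)) => b; nra.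
Qed.

Lemma rnorm_sqrt_iter_le n x : rnorm (sqrt_iter Q n x) <= rnorm x.
Proof.
rewrite (le_trans (rnorm_sqrt_iter n x))// ler_piMl ?rnorm_ge0//.
by case: (majorant_itv n).
Qed.

(** From the factorization [Y'^2 - Y^2 = Y' (Y' - Y) + (Y' - Y) Y], which holds
    without commutation; for the majorants, the same factorization is an
    equality. *)
Lemma sqrt_iter_step n x :
  rnorm (sqrt_iter Q n.+1 x - sqrt_iter Q n x)
    <= (majorant n.+1 - majorant n) * rnorm x.
Proof.
elim: n x => [|n IH] x.
  rewrite sqrt_iterS subr0 addr0 rnorm_half majorantS /=.
  by have := Q1 x; lra.
set Y := sqrt_iter Q n; set Y' := sqrt_iter Q n.+1.
have -> : sqrt_iter Q n.+2 x - Y' x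
    = (2^-1)%:C *: (Y' (Y' x - Y x) + (Y' (Y x) - Y (Y x))).
  rewrite sqrt_iterS {3}/Y' sqrt_iterS -scalerBr; congr (_ *: _).
  by rewrite opprD addrACA subrr add0r bopD bopN addrA subrK.
rewrite rnorm_half.
have := rnormD (Y' (Y' x - Y x)) (Y' (Y x) - Y (Y x)).
have := rnorm_sqrt_iter n.+1 (Y' x - Y x); have := IH (Y x); have := IH x.
have := rnorm_sqrt_iter n x; rewrite [majorant n.+2]majorantS -/Y -/Y'.
have [s0 _] := majorant_itv n.+1.
have sE := majorantS n.
have st : majorant n <= majorant n.+1.
  by rewrite sE; have := sqr_ge0 (1 - majorant n); lra.
move: (majorant n.+1) (majorant n) s0 sE st => s t s0 sE st c1 b1 c2 b2.
rewrite -subr_ge0 in st; have := ler_wpM2l s0 b1; have := ler_wpM2l st c1.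
have -> : (1 + s ^+ 2) / 2 - s = (s + t) * (s - t) / 2.
  by rewrite [in - s]sE; field.
by lra.
Qed.

Lemma sqrt_iter_close n m x : (n <= m)%N ->
  rnorm (sqrt_iter Q m x - sqrt_iter Q n x)
    <= (majorant m - majorant n) * rnorm x.
Proof.
move=> /subnK <-; elim: (m - n)%N => [|k IH].
  by rewrite !subrr rnorm0 mul0r.
rewrite -(subrK (sqrt_iter Q (k + n) x) (sqrt_iter Q _ x)) -addrA.
rewrite (le_trans (rnormD _ _))//.
by have := sqrt_iter_step (k + n) x; have := IH; rewrite addSn; lra.
Qed.

Lemma symmetric_sqrt_iter n : symmetric_op (sqrt_iter Q n).
Proof.
elim: n => [|n IH] x y; first by rewrite /= /rinner linear0l linear0r.
by rewrite !sqrt_iterS rinnerZl rinnerZr rinnerDl rinnerDr Qsym !IH.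
Qed.

End Contraction.

(** The limit [Y] of the iteration is a symmetric contraction, so that [1 - Y]
    is positive, and its fixed point equation says that [1 - Y] squares to
    [P]. *)
Lemma sqrt_contraction P : symmetric_op P ->
  (forall x, rnorm (x - P x) <= rnorm x) ->
  exists B : 'B(H), positive_op B /\ B ^+ 2 = P.
Proof.
move=> Psym P1; pose Q : 'B(H) := 1 - P.
have Q1 x : rnorm (Q x) <= rnorm x by exact: P1.
have Qsym : symmetric_op Q.
  by move=> x y; rewrite rinnerDl rinnerNl rinnerDr rinnerNr Psym.
have [n m nm x|Y YQ] := @bop_complete R H (sqrt_iter Q) 2.
  apply: le_trans (sqrt_iter_close Q1 x nm) _.
  rewrite mulrAC ler_wpM2r ?rnorm_ge0//; apply: le_trans (majorant_rate n).
  by rewrite lerD2r; case: (majorant_itv m).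
have Yle x : rnorm (Y x) <= rnorm x.
  rewrite -subr_le0; apply: (@le0_rate _ _ (2 * rnorm x)) => n.
  have := YQ n x; have := rnorm_sqrt_iter_le Q1 n x.
  have := rnormD (Y x - sqrt_iter Q n x) (sqrt_iter Q n x); rewrite subrK.
  by move: n.+1%:R^-1 => e; lra.
have Ysym : symmetric_op Y.
  move=> x y; apply/eqP; rewrite -subr_eq0 -normr_le0.
  apply: (@le0_rate _ _ (4 * rnorm x * rnorm y)) => n.
  have -> : rinner (Y x) y - rinner x (Y y) =
      rinner (Y x - sqrt_iter Q n x) y - rinner x (Y y - sqrt_iter Q n y).
    rewrite rinnerDl rinnerNl rinnerDr rinnerNr (symmetric_sqrt_iter Qsym).
    ring.
  rewrite (le_trans (ler_normB _ _))//.
  have := norm_rinner_le (Y x - sqrt_iter Q n x) y.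
  have := norm_rinner_le x (Y y - sqrt_iter Q n y).
  have := ler_wpM2r (rnorm_ge0 y) (YQ n x).
  have := ler_wpM2l (rnorm_ge0 x) (YQ n y).
  by move: n.+1%:R^-1 => e; lra.
have YE x : Y x = (2^-1)%:C *: (Q x + Y (Y x)).
  apply/eqP; rewrite -subr_eq0; apply/eqP.
  apply: (@rnorm_rate0 _ _ _ (4 * rnorm x)) => n.
  set Yn := sqrt_iter Q n.
  have -> : Y x - (2^-1)%:C *: (Q x + Y (Y x)) = (Y x - sqrt_iter Q n.+1 x) -
      (2^-1)%:C *: ((Y (Y x) - Yn (Y x)) + Yn (Y x - Yn x)).
    have -> : Y (Y x) - Yn (Y x) + Yn (Y x - Yn x) = Y (Y x) - Yn (Yn x).
      by rewrite bopD bopN addrA subrK.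
    rewrite sqrt_iterS -/Yn -[RHS]addrA -opprD -scalerDr; congr (_ - _ *: _).
    by rewrite -[RHS]addrA (addrC (Yn (Yn x))) subrK.
  rewrite (le_trans (rnormD _ _))// rnormN rnorm_half.
  have e0 := @rate_gt0 R n.
  have x2 : 0 <= 2 * rnorm x by rewrite mulr_ge0 ?rnorm_ge0.
  have Y1 : rnorm (Y x - sqrt_iter Q n.+1 x) <= 2 * rnorm x * n.+1%:R^-1.
    by rewrite (le_trans (YQ n.+1 x))// ler_wpM2l// rate_anti.
  have Y2 : rnorm (Y (Y x) - Yn (Y x)) <= 2 * rnorm x * n.+1%:R^-1.
    by rewrite (le_trans (YQ n (Y x)))// ler_pM2r// ler_pM2l.
  have := rnormD (Y (Y x) - Yn (Y x)) (Yn (Y x - Yn x)).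
  have := rnorm_sqrt_iter_le Q1 n (Y x - Yn x); have := YQ n x.
  by rewrite -/Yn; move: n.+1%:R^-1 Y1 Y2 {e0} => e; lra.
exists (1 - Y); split.
  apply: symmetric_positive.
    by move=> x y; rewrite rinnerDl rinnerNl rinnerDr rinnerNr Ysym.
  move=> x; rewrite rinnerDl rinnerNl rinnerxx.
  have := rinner_le (Y x) x; have := Yle x; have := rnorm_ge0 x; nra.
apply/val_inj/funext => x.
change ((x - Y x) - Y (x - Y x) = P x).
have two : (2 : R[i]) * (2^-1)%:C = 1.
  by rewrite -(rmorph_nat (real_complex R)) -rmorphM mulfV// pnatr_eq0.
have YY : Y x + Y x = x - P x + Y (Y x).
  by rewrite -mulr2n -scaler_nat {1}YE scalerA two scale1r.
rewrite bopD bopN opprD opprK addrA -(addrA x) -opprD YY opprD addrA subrK.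
by rewrite opprB addrC subrK.
Qed.

(** With [s = 1 / M^2] for a bound [M] of [C], the operator [P = s C^* C]
    satisfies the contraction hypothesis above:
    [|x - P x|^2 = |x|^2 - 2 s |C x|^2 + s^2 |C^* C x|^2], where the last term
    is at most [s |C x|^2]. *)
Lemma sqrt_adjointM_exists C :
  exists B : 'B(H), positive_op B /\ B ^+ 2 = adjoint C * C.
Proof.
have [M M0 CM] := bop_bound C.
have DM := rnorm_adjoint (ltW M0) CM.
pose s : R := (M ^+ 2)^-1.
have s0 : 0 < s by rewrite invr_gt0 exprn_gt0.
have sM : s * M ^+ 2 = 1 by rewrite mulVf// gt_eqF// exprn_gt0.
have CC x y : rinner (adjoint C (C x)) y = rinner (C x) (C y).
  by rewrite rinnerC -rinner_adjoint rinnerC.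
have [x y|x|B [B0 BE]] := @sqrt_contraction (s%:C *: (adjoint C * C)).
- rewrite rinnerZl rinnerZr; congr (_ * _); rewrite [RHS]rinnerC.
  by rewrite [LHS]CC [RHS]CC rinnerC.
- change (rnorm (x - s%:C *: adjoint C (C x)) <= rnorm x).
  rewrite -(@ler_pXn2r _ 2) ?nnegrE ?rnorm_ge0// rnormD_sqr rnormN.
  rewrite rinnerNr rinnerZr [rinner x _]rinnerC CC.
  rewrite rinnerxx rnormZr exprMn real_normK ?num_real//.
  have sD : s * rnorm (adjoint C (C x)) ^+ 2 <= rnorm (C x) ^+ 2.
    rewrite -[leRHS]mul1r -sM -mulrA ler_pM2l// -exprMn.
    by rewrite ler_pXn2r ?DM// nnegrE ?rnorm_ge0// mulr_ge0 ?rnorm_ge0 ?ltW.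
  by have := ler_wpM2l (ltW s0) sD; have := sqr_ge0 (rnorm (C x)); nra.
exists (M%:C *: B); split.
  by move=> x; rewrite /= linearZl_LR /= mulr_ge0// ler0c ltW.
apply/val_inj/funext => x.
change (M%:C *: B (M%:C *: B x) = adjoint C (C x)).
have BBx : B (B x) = s%:C *: adjoint C (C x).
  exact: (congr1 (fun T : 'B(H) => T x) BE).
by rewrite bopZ BBx !scalerA -!rmorphM /= -expr2 mulrC sM scale1r.
Qed.

Lemma sqr_abs_op C : abs_op C ^+ 2 = adjoint C * C.
Proof.
have [B BP] := sqrt_adjointM_exists C; rewrite /abs_op /sqrt_op.
by case: xgetP => [_ _ [] //|/(_ B)].
Qed.

Lemma inner_sqr_abs_op C x : inner ((abs_op C ^+ 2) x) x = inner (C x) (C x).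
Proof.
rewrite sqr_abs_op [LHS]hermC expr0 mul1r /= -adjointP innerxx.
exact: conjc_real.
Qed.

End SquareRoot.

(** * Positive semidefinite real matrices *)

Section Gram.
Context {R : realType}.

(** The real part of the Hermitian form of a real matrix at [p + 'i q] is the
    sum of the values of its quadratic form at [p] and at [q]. *)
Lemma Re_psdmx_ge0 n (M : 'M[R]_n) (v : 'rV[R[i]]_n) : psdmx M ->
  0 <= complex.Re
    ((v *m map_mx (real_complex R) M *m (v ^t Num.conj)%sesqui) 0 0).
Proof.
move=> [_ M0].
pose re : 'rV[R]_n := map_mx (@complex.Re R) v.
pose im : 'rV[R]_n := map_mx (@complex.Im R) v.
suff -> : complex.Re
    ((v *m map_mx (real_complex R) M *m (v ^t Num.conj)%sesqui) 0 0)
    = (re *m M *m re^T) 0 0 + (im *m M *m im^T) 0 0 by rewrite addr_ge0.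
rewrite !mxE raddf_sum -big_split /=; apply: eq_bigr => j _.
rewrite !mxE !mulr_suml raddf_sum -big_split /=; apply: eq_bigr => i _.
rewrite !mxE; case: (v 0 i) => a b; case: (v 0 j) => c d /=; ring.
Qed.

(** The spectral decomposition of [M] over the complex numbers; the eigenvalue
    [d k] is nonnegative because it is the value of the form at the [k]-th
    eigenvector. *)
Lemma psdmx_sum_rank1 n (M : 'M[R]_n) : psdmx M ->
  exists (d : 'I_n -> R) (P : 'M[R[i]]_n), (forall k, 0 <= d k) /\
    forall i j, (M i j)%:C = \sum_k (d k)%:C * ((P k i)^* * P k j).
Proof.
move=> Mpsd; have [Msym _] := Mpsd.
set A := map_mx (real_complex R) M.
have Aherm : A \is hermsymmx.
  apply/is_hermitianmxP; rewrite expr0 scale1r; apply/matrixP => i j.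
  by rewrite !mxE -{1}Msym mxE; exact/esym/conjc_real.
have spreal := hermitian_spectral_diag_real Aherm.
have /hermitian_normalmx/orthomx_spectralP := Aherm.
have Pu := spectral_unitarymx A.
rewrite invmx_unitary//; move: Pu spreal.
set P := spectralmx A; set D := spectral_diag A => Pu Dreal AE.
exists (fun k => complex.Re (D 0 k)), P; split=> [k|i j].
  have -> : D 0 k = (row k P *m A *m ((row k P) ^t Num.conj)%sesqui) 0 0.
    have -> : row k P *m A *m ((row k P) ^t Num.conj)%sesqui
        = row k P *m (P ^t Num.conj)%sesqui *m diag_mx D
            *m (P *m ((row k P) ^t Num.conj)%sesqui).
      by rewrite AE !mulmxA.
    rewrite -row_mul tr_row map_col [X in _ *m (P *m X)]colE.
    rewrite [P *m (_ *m _)]mulmxA (unitarymxP Pu) mul1mx row1 -rowE -colE.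
    by rewrite !mxE eqxx.
  exact: Re_psdmx_ge0.
have -> : (M i j)%:C = A i j by rewrite mxE.
rewrite {1}AE mxE; apply: eq_bigr => k _.
rewrite mul_mx_diag !mxE RRe_real; last exact: (mxOverP Dreal).
by rewrite mulrAC mulrC mulrA.
Qed.

(** Equivalently, the entrywise product of [M] with a Gram matrix has a
    nonnegative sum of entries. *)
Lemma psdmx_gram_ge0 (H : hilbertType R) n (M : 'M[R]_n) (y : 'I_n -> H) :
  psdmx M -> 0 <= \sum_i \sum_j (M i j)%:C * inner (y i) (y j).
Proof.
move=> /psdmx_sum_rank1[d [P [d0 ME]]].
suff -> : \sum_i \sum_j (M i j)%:C * inner (y i) (y j) =
    \sum_k (d k)%:C *
      inner (\sum_i (P k i)^* *: y i) (\sum_i (P k i)^* *: y i).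
  apply: sumr_ge0 => k _; rewrite innerxx -rmorphM ler0c.
  by rewrite mulr_ge0 ?exprn_ge0 ?rnorm_ge0.
transitivity (\sum_i \sum_j \sum_k
    (d k)%:C * ((P k i)^* * P k j) * inner (y i) (y j)).
  by apply: eq_bigr => i _; apply: eq_bigr => j _; rewrite ME mulr_suml.
under eq_bigr do rewrite exchange_big.
rewrite exchange_big; apply: eq_bigr => k _ /=.
rewrite linear_sumlz mulr_sumr; apply: eq_bigr => i _.
rewrite linear_sumr mulr_sumr; apply: eq_bigr => j _.
rewrite linearZl_LR linearZr_LR /= conjCK; ring.
Qed.

End Gram.

(** * Quadratic forms of the operators in the inequalities *)

Section QuadraticForm.
Context {R : realType} {H : hilbertType R}.

Lemma bop_sumE I (r : seq I) (F : I -> 'B(H)) x :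
  (\sum_(i <- r) F i) x = \sum_(i <- r) F i x.
Proof. exact: (big_morph (fun T : 'B(H) => T x)). Qed.

Variables (n : nat) (A : 'I_n -> 'B(H)) (x : H).

Definition gram (M : 'M[R]_n) : R[i] :=
  \sum_i \sum_j (M i j)%:C * inner (A i x) (A j x).

Lemma gramD M N : gram (M + N) = gram M + gram N.
Proof.
rewrite /gram -big_split; apply: eq_bigr => i _ /=.
by rewrite -big_split; apply: eq_bigr => j _ /=; rewrite mxE rmorphD mulrDl.
Qed.

Lemma gramN M : gram (- M) = - gram M.
Proof.
rewrite /gram -sumrN; apply: eq_bigr => i _.
by rewrite -sumrN; apply: eq_bigr => j _ /=; rewrite mxE rmorphN mulNr.
Qed.

Lemma gram_Lambda (a : 'rV[R]_n) :
  gram (Lambda a) = inner ((abs_op (\sum_i (a 0 i)%:C *: A i) ^+ 2) x) x.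
Proof.
rewrite inner_sqr_abs_op bop_sumE linear_sumlz; apply: eq_bigr => i _.
rewrite linear_sumr; apply: eq_bigr => j _.
rewrite linearZl_LR linearZr_LR /= mxE rmorphM -mulrA; congr (_ * (_ * _)).
exact/esym/conjc_real.
Qed.

Lemma gram_diag_mx (c : 'rV[R]_n) :
  gram (diag_mx c) = inner ((\sum_i (c 0 i)%:C *: abs_op (A i) ^+ 2) x) x.
Proof.
rewrite bop_sumE linear_sumlz; apply: eq_bigr => i _.
rewrite linearZl_LR /= inner_sqr_abs_op (bigD1 i)//= mxE eqxx mulr1n.
rewrite big1 ?addr0//.
by move=> j ji; rewrite mxE eq_sym (negbTE ji) mulr0n mul0r.
Qed.

End QuadraticForm.

Theorem theorem2p1 (R : realType) (H : hilbertType R) (sepH : separable_space H)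
    (n : nat) (a b c : 'rV[R]_n) :
  (mx_le (Lambda a + Lambda b) (diag_mx c) ->
   forall A : 'I_n -> 'B(H),
     op_le (abs_op (\sum_(i < n) (a 0 i)%:C *: A i) ^+ 2
            + abs_op (\sum_(i < n) (b 0 i)%:C *: A i) ^+ 2)
           (\sum_(i < n) (c 0 i)%:C *: abs_op (A i) ^+ 2)) /\
  (mx_le (diag_mx c) (Lambda a + Lambda b) ->
   forall A : 'I_n -> 'B(H),
     op_le (\sum_(i < n) (c 0 i)%:C *: abs_op (A i) ^+ 2)
           (abs_op (\sum_(i < n) (a 0 i)%:C *: A i) ^+ 2
            + abs_op (\sum_(i < n) (b 0 i)%:C *: A i) ^+ 2)).
Proof.
by split=> /psdmx_gram_ge0 M0 A x; have := M0 H (fun i => A i x);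
  rewrite -/(gram A x _) !(gramD, gramN) gram_diag_mx !gram_Lambda /=
    linearBl linearDl.
Qed.
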